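(* Let $(\Omega,\Lambda)$ be a generalized spectral pair in $\mathbb{R}^d$ with frame constants $(k,K)$. Let $B,L\subset\mathbb{R}^d$ be finite sets such that the translates $\Omega+b$ $(b\in B)$ are non-overlapping (pairwise intersections are Lebesgue null sets) and the translates $\Lambda+\ell$ $(\ell\in L)$ are pairwise disjoint. Suppose $B\subset\Lambda^\circ$. Let $\mathcal{M}:=(e^{i2\pi b\cdot\ell})_{\ell\in L,\,b\in B}$ be the matrix with rows indexed by $L$ and columns indexed by $B$, and suppose that $\mathcal{M}^*\mathcal{M}$ is bounded below, equivalently invertible, on $\ell^2_B=\mathbb{C}^B$. Then there are constants $p,P$ with $p>0$ such that $$p\|v\|_{\ell^2_B}^2\le\langle v,\mathcal{M}^*\mathcal{M}v\rangle_{\ell_B^2}\le P\|v\|_{\ell_B^2}^2\quad\text{for all } v\in\ell^2_B,$$ and for any such constants, $(\Omega+B,\Lambda+L)$ is a generalized spectral pair with frame constants $$k_1=kp\quad\text{and}\quad K_1=KP .$$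
   Context: $m_d$ is Lebesgue measure on $\mathbb{R}^d$ and $e_\lambda(x):=e^{i2\pi\lambda\cdot x}$. For a measurable set $\Omega\subset\mathbb{R}^d$ with $0<m_d(\Omega)<\infty$ and $f\in L^2(\Omega)$ (Lebesgue measure), put $\|f\|_\Omega^2=\int_\Omega|f|^2\,dx$ and $\hat f(\lambda):=\int_\Omega\overline{e_\lambda(x)}f(x)\,dx$. A pair $(\Omega,\Lambda)$ with $\Omega\subset\mathbb{R}^d$ measurable, $0<m_d(\Omega)<\infty$, and $\Lambda\subset\mathbb{R}^d$ is a generalized spectral pair with frame constants $(k,K)$, $0<k\le K<\infty$, if $k\|f\|_\Omega^2\le\sum_{\lambda\in\Lambda}|\hat f(\lambda)|^2\le K\|f\|_\Omega^2$ for all $f\in L^2(\Omega)$. Notation: $\Lambda^\circ:=\{t\in\mathbb{R}^d: t\cdot\lambda\in\mathbb{Z}\ \forall\lambda\in\Lambda\}$, $\Omega+B:=\bigcup_{b\in B}(\Omega+b)$, $\Lambda+L:=\bigcup_{\ell\in L}(\Lambda+\ell)$. *)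

(* Defs.v *)
From HB Require Import structures.
From mathcomp Require Import all_boot all_order all_algebra finmap.
From mathcomp Require Import complex.
From mathcomp Require Import all_classical all_reals all_analysis.

Set Implicit Arguments.
Unset Strict Implicit.
Unset Printing Implicit Defensive.
Import Order.TTheory GRing.Theory Num.Theory.
Import numFieldNormedType.Exports.

Local Open Scope classical_set_scope.
Local Open Scope ring_scope.
Local Open Scope complex_scope.
Local Open Scope sesquilinear_scope.

Section lebesgue_measure_on_Rd.
Context {R : realType} {d : nat}.
Implicit Types (a b x : 'rV[R]_d) (X : set 'rV[R]_d).

Definition box a b : set 'rV[R]_d :=
  [set x | forall i, a 0 i < x 0 i <= b 0 i].

Definition volume a b : R := \prod_(i < d) Num.max 0 (b 0 i - a 0 i).

Lemma volume_ge0 a b : 0 <= volume a b.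
Proof. by apply: prodr_ge0 => i _; rewrite le_max lexx. Qed.

(* A cover is a countable set of boxes, each given by its two corners. *)
Definition box_cover X : set (set ('rV[R]_d * 'rV[R]_d)) :=
  [set C | countable C /\ X `<=` \bigcup_(p in C) box p.1 p.2].

Definition lebesgue_outer X : \bar R :=
  ereal_inf [set \esum_(p in C) (volume p.1 p.2)%:E | C in box_cover X].

Let V (p : 'rV[R]_d * 'rV[R]_d) : \bar R := (volume p.1 p.2)%:E.

Let V_ge0 p : (0 <= V p)%E. Proof. by rewrite lee_fin volume_ge0. Qed.

Lemma lebesgue_outer0 : lebesgue_outer set0 = 0%E.
Proof.
apply/eqP; rewrite eq_le; apply/andP; split.
  by apply: ereal_inf_lbound; exists set0; [split|rewrite esum_set0].
by apply: le_ereal_inf_tmp => _ [C _ <-]; apply: esum_ge0 => p _; exact: V_ge0.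
Qed.

Lemma lebesgue_outer_ge0 X : (0 <= lebesgue_outer X)%E.
Proof.
by apply: le_ereal_inf_tmp => _ [C _ <-]; apply: esum_ge0 => p _; exact: V_ge0.
Qed.

Lemma le_lebesgue_outer : {homo lebesgue_outer : A B / A `<=` B >-> (A <= B)%E}.
Proof.
move=> A B AB; apply: ereal_inf_le_tmp => _ [C [cC BC] <-].
by exists C => //; split => //; apply: subset_trans BC.
Qed.

Let esum_bigcup_le (C : nat -> set ('rV[R]_d * 'rV[R]_d)) :
  (\esum_(p in \bigcup_n C n) V p <= \sum_(n <oo) \esum_(p in C n) V p)%E.
Proof.
apply: ge_ereal_sup => _ [A [finA AC] <-].
have [g gP] : {g : 'rV[R]_d * 'rV[R]_d -> nat & forall p, A p -> C (g p) p}.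
  apply: (@choice _ _ (fun p n => A p -> C n p)) => p.
  have [Ap|nAp] := pselect (A p); last by exists 0%N.
  by have [n _ Cn] := AC _ Ap; exists n.
rewrite nneseries_esumT; last by move=> n; apply: esum_ge0 => p _; exact: V_ge0.
have -> : (\sum_(p \in A) V p = \esum_(p in A) V p)%E by rewrite esum_fset.
have -> : A = \bigcup_n (A `&` (g @^-1` [set n])).
  by apply/seteqP; split => [p Ap|p [n _ []//]]; exists (g p).
rewrite esum_bigcupT//; last first.
  by apply/trivIsetP => i j _ _ ij; apply/seteqP; split => // p [[_ /= gi] [_ /= gj]];
    move: ij; rewrite -gi -gj eqxx.
apply: le_esum => n _; apply: ge_ereal_sup => _ [D [finD DA] <-].
apply: ereal_sup_ubound; exists D => //; split => // p /DA[Ap /= <-].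
exact: gP.
Qed.

Lemma lebesgue_outer_sigma_subadditive : sigma_subadditive lebesgue_outer.
Proof.
move=> A; have [[i ioo]|] := pselect (exists i, lebesgue_outer (A i) = +oo%E).
  rewrite (eseries_pinfty _ _ ioo) ?leey// => n _.
  by rewrite -ltNye (lt_le_trans _ (lebesgue_outer_ge0 _)).
rewrite -forallNE => Aoo.
apply/lee_addgt0Pr => e e0.
rewrite (le_trans _ (epsilon_trick _ _ (ltW e0)))//; last first.
  by move=> n; exact: lebesgue_outer_ge0.
have [G PG] : {G & forall n, box_cover (A n) (G n) /\
    (\esum_(p in G n) V p <= lebesgue_outer (A n) + (e / (2 ^ n.+1)%:R)%:E)%E}.
  apply: (@choice _ _ (fun n C => box_cover (A n) C /\
    (\esum_(p in C) V p <= lebesgue_outer (A n) + (e / (2 ^ n.+1)%:R)%:E)%E)) => n.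
  have fin : lebesgue_outer (A n) \is a fin_num.
    rewrite ge0_fin_numE ?lebesgue_outer_ge0// ltey; exact/eqP/Aoo.
  have en : 0 < e / (2 ^ n.+1)%:R :> R by rewrite divr_gt0// ltr0n expn_gt0.
  have [_ [C cC <-] /ltW lt] := lb_ereal_inf_adherent en fin.
  by exists C.
apply: (@le_trans _ _ (\esum_(p in \bigcup_n G n) V p)).
  apply: ereal_inf_lbound; exists (\bigcup_n G n) => //; split.
    by apply: bigcup_countable => // n _; have [[]] := PG n.
  move=> x [n _ Ax]; have [[_ /(_ _ Ax)[p Gp xp]] _] := PG n.
  by exists p => //; exists n.
apply: (le_trans (esum_bigcup_le _)).
by apply: lee_nneseries => n *; [apply: esum_ge0 => p _; exact: V_ge0|exact: (PG n).2].
Qed.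

HB.instance Definition _ := isOuterMeasure.Build R 'rV[R]_d lebesgue_outer
  lebesgue_outer0 lebesgue_outer_ge0 le_lebesgue_outer
  lebesgue_outer_sigma_subadditive.

(* 'rV[R]_d carries the sigma-algebra of Lebesgue (not only Borel) sets. *)
HB.instance Definition _ :=
  Measurable.copy 'rV[R]_d (caratheodory_type lebesgue_outer).

Definition lebesgue : set 'rV[R]_d -> \bar R := lebesgue_outer.

HB.instance Definition _ := isMeasure.Build _ 'rV[R]_d R lebesgue
  (@caratheodory_measure0 _ _ lebesgue_outer)
  (@caratheodory_measure_ge0 _ _ lebesgue_outer)
  (@caratheodory_measure_sigma_additive _ _ lebesgue_outer).

End lebesgue_measure_on_Rd.

Section spectral_pairs.
Context {R : realType} {d : nat}.
Implicit Types (x y : 'rV[R]_d) (Omega Lambda : set 'rV[R]_d)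
  (f : 'rV[R]_d -> R[i]).

Definition dot x y : R := \sum_(i < d) x 0 i * y 0 i.

Definition expi (lambda x : 'rV[R]_d) : R[i] :=
  cos (2 * pi * dot lambda x) +i* sin (2 * pi * dot lambda x).

Definition sqnormL2 Omega f : \bar R :=
  \int[lebesgue]_(x in Omega) (Normc.normc (f x) ^+ 2)%:E.

(* Representatives defined on the whole space; only values on Omega matter. *)
Definition L2 Omega f : Prop :=
  [/\ measurable_fun Omega (fun x => complex.Re (f x)),
      measurable_fun Omega (fun x => complex.Im (f x)) &
      (sqnormL2 Omega f < +oo)%E].

Definition cintegral Omega f : R[i] :=
  (\int[lebesgue]_(x in Omega) complex.Re (f x)) +i*
  (\int[lebesgue]_(x in Omega) complex.Im (f x)).

Definition fourier Omega f (lambda : 'rV[R]_d) : R[i] :=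
  cintegral Omega (fun x => (expi lambda x)^* * f x).

Definition generalized_spectral_pair Omega Lambda (k K : R) : Prop :=
  [/\ measurable Omega, (0 < lebesgue Omega < +oo)%E, 0 < k <= K &
    forall f, L2 Omega f ->
      (k%:E * sqnormL2 Omega f
        <= \esum_(lambda in Lambda) (Normc.normc (fourier Omega f lambda) ^+ 2)%:E
        <= K%:E * sqnormL2 Omega f)%E].

Definition dual_set Lambda : set 'rV[R]_d :=
  [set t | forall lambda, Lambda lambda -> dot t lambda \is a Num.int].

Definition translate (A : set 'rV[R]_d) (b : 'rV[R]_d) : set 'rV[R]_d :=
  [set x + b | x in A].

Definition translates (A : set 'rV[R]_d) (B : {fset 'rV[R]_d}) : set 'rV[R]_d :=
  \bigcup_(b in [set` B]) translate A b.

(* Row i (column j) is attached to the i-th (j-th) element of L (of B) in the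
   duplicate-free enumeration of the finite set. *)
Definition exp_mx (L B : {fset 'rV[R]_d}) : 'M[R[i]]_(#|` L|, #|` B|) :=
  \matrix_(i, j) expi (enum_fset B)`_j (enum_fset L)`_i.

End spectral_pairs.

Section hermitian_forms.
Context {R : realType} {n : nat}.
Implicit Types (u v : 'cV[R[i]]_n) (A : 'M[R[i]]_n).

Definition inner u v : R[i] := \sum_(i < n) (u i 0)^* * v i 0.

Definition sqnorml2 v : R := \sum_(i < n) Normc.normc (v i 0) ^+ 2.

Definition bounded_below A : Prop :=
  exists2 c : R, 0 < c &
    forall v, c * Num.sqrt (sqnorml2 v) <= Num.sqrt (sqnorml2 (A *m v)).

(* The order of R[i] only compares numbers with the same imaginary part, so
   this also says that <v, A v> is real. *)
Definition form_bounds A (p P : R) : Prop :=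
  forall v, (p * sqnorml2 v)%:C <= inner v (A *m v) <= (P * sqnorml2 v)%:C.

End hermitian_forms.

(* Main.v *)
From HB Require Import structures.
Require Import Defs.
From mathcomp Require Import all_boot all_order all_algebra finmap.
From mathcomp Require Import complex.
From mathcomp Require Import all_classical all_reals all_analysis.
From mathcomp Require Import measurable_realfun.
From mathcomp Require Import lra.

(** Write D for Omega + B and M for the matrix with entries e_l(b). Since the
    translates Omega + b overlap only in null sets, the integral over D of a
    function h is the integral over Omega of its periodization
    sum_b h(x + b) ([ge0_integral_periodize], [Rintegral_periodize]). Apply
    this to the integral defining the Fourier transform of f at lambda + l.
    The factor e_lambda(x + b) equals e_lambda(x), because b . lambda is an
    integer, so it leaves the sum over b: the transform of f over D at
    lambda + l is the transform over Omega at lambda of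
      g_l(x) = sum_b conj(e_l(x + b)) f(x + b)
    ([fourier_periodize]).

    For each fixed l, the frame inequality of (Omega, Lambda) applied to g_l
    compares the sum over Lambda of |fourier g_l|^2 with |g_l|^2. As the sets
    Lambda + l are disjoint, adding these inequalities over l gives on one side
    the sum over Lambda + L of |fourier f|^2 ([esum_translates]), and on the
    other the multiples by k and K of the sum over l of the squared norms of
    the g_l. Pointwise, |g_l(x)| is the modulus of the l-th entry of M v(x),
    where v(x) is the vector of the conj(f(x + b))
    ([sqnorml2_exp_mx_samples]), so sum_l |g_l(x)|^2 = <v(x), M^* M v(x)> lies
    between p |v(x)|^2 and P |v(x)|^2. Integrating over Omega and undoing the
    periodization of |f|^2 yields p |f|^2 and P |f|^2
    ([sum_sqnormL2_bounds]).

    Two facts about Lebesgue measure on R^d have to be derived from the outer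
    measure by coverings with boxes: it is invariant under translations
    ([lebesgue_translate], [measurable_translate]), and coordinate functions,
    hence the characters e_l, are measurable ([measurable_halfspace]). The
    latter is what makes g_l an L^2 function, to which the frame inequality may
    be applied. *)

Set Implicit Arguments.
Unset Strict Implicit.
Unset Printing Implicit Defensive.
Import Order.TTheory GRing.Theory Num.Theory.
Import numFieldNormedType.Exports.

Local Open Scope classical_set_scope.
Local Open Scope ring_scope.
Local Open Scope complex_scope.
Local Open Scope sesquilinear_scope.

(** * Lebesgue measure: translations and coordinates *)

(** Two boxes of a covering may be cut into the same piece, so the map that
    cuts boxes need not be injective on a covering; an inequality suffices. *)
Lemma esum_image_le {R : realType} (T T' : choiceType) (P : set T) (e : T -> T')
    (u : T' -> \bar R) : (forall y, 0 <= u y)%E ->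
  (\esum_(y in e @` P) u y <= \esum_(x in P) u (e x))%E.
Proof.
move=> u0.
have [g gP] : {g : T' -> option T & forall y, (e @` P) y ->
    exists2 x, g y = Some x & P x /\ e x = y}.
  apply: (@choice _ _ (fun y o => (e @` P) y ->
    exists2 x, o = Some x & P x /\ e x = y)) => y.
  have [[x Px exy]|ny] := pselect ((e @` P) y); last by exists None.
  by exists (Some x) => _; exists x.
(* Q keeps one preimage of each point of the image. *)
pose Q := [set x | P x /\ g (e x) = Some x].
have -> : e @` P = e @` Q.
  apply/seteqP; split => [y /gP[x gy [Px exy]]|_ [x [Px _] <-]]; last by exists x.
  by exists x => //; split => //; rewrite exy.
rewrite esum_image; last first.
  move=> x y; rewrite !inE => -[_ gx] [_ gy] exy.
  by move: gx; rewrite exy gy => -[].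
rewrite [leRHS](esumID Q)// (_ : P `&` Q = Q); last first.
  by apply/seteqP; split => [x []//|x Qx]; split => //; case: Qx.
by rewrite leeDl// esum_ge0.
Qed.

Lemma max0_cut {R : realType} (a b r : R) :
  Num.max 0 (Num.min b r - a) + Num.max 0 (b - Num.max a r) = Num.max 0 (b - a).
Proof.
have max0 (x : R) : x <= 0 -> Num.max 0 x = 0 by move=> ?; exact/max_idPl.
have maxid (x : R) : 0 <= x -> Num.max 0 x = x by move=> ?; exact/max_idPr.
have [br|/ltW rb] := leP b r.
  by rewrite [X in _ + X]max0 ?addr0// subr_le0 le_max br orbT.
have [ar|/ltW ra] := leP a r; last by rewrite max0 ?add0r// subr_le0.
by rewrite !maxid ?subr_ge0//; [rewrite addrC subrKA | exact: le_trans rb].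
Qed.

Section outer_measure.
Context {R : realType} {d : nat}.
Implicit Types (a b c t x : 'rV[R]_d) (X : set 'rV[R]_d).

Lemma translateE X t : translate X t = [set x | X (x - t)].
Proof.
apply/seteqP; split => [_ [y Xy <-]|x Xx]; rewrite /= ?addrK//.
by exists (x - t) => //; rewrite subrK.
Qed.

Lemma volume_translate a b t : volume (a + t) (b + t) = volume a b.
Proof.
by apply: eq_bigr => i _; rewrite !mxE opprD addrACA subrr addr0.
Qed.

Let vol_ge0 (p : 'rV[R]_d * 'rV[R]_d) : (0 <= (volume p.1 p.2)%:E)%E.
Proof. by rewrite lee_fin volume_ge0. Qed.

Let shift t (p : 'rV[R]_d * 'rV[R]_d) : 'rV[R]_d * 'rV[R]_d :=
  (p.1 + t, p.2 + t).

Lemma lebesgue_translate X t : lebesgue (translate X t) = lebesgue X.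
Proof.
have shift_le (Y : set 'rV[R]_d) (s : 'rV[R]_d) :
    (lebesgue (translate Y s) <= lebesgue Y)%E.
  apply: le_ereal_inf_tmp => _ [C [cC YC] <-].
  apply: (@le_trans _ _ (\esum_(p in shift s @` C) (volume p.1 p.2)%:E)).
    apply: ereal_inf_lbound; exists (shift s @` C) => //; split.
      by apply: sub_countable cC; exact: card_image_le.
    rewrite translateE => x /YC[p Cp px]; exists (shift s p); first by exists p.
    by move=> i /=; have := px i; rewrite !mxE ltrBrDr lerBlDr.
  apply: (le_trans (esum_image_le C (shift s) vol_ge0)).
  by apply: le_esum => p _; rewrite /= volume_translate.
apply/eqP; rewrite eq_le shift_le/=.
rewrite -{1}(_ : translate (translate X t) (- t) = X) ?shift_le//.
by rewrite !translateE; apply/seteqP; split => x /=; rewrite opprK addrK.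
Qed.

Lemma translateI X (Y : set 'rV[R]_d) t :
  translate X t `&` Y = translate (X `&` translate Y (- t)) t.
Proof.
by rewrite !translateE; apply/seteqP; split => x /= []; rewrite opprK subrK.
Qed.

Lemma translateC X t : ~` translate X t = translate (~` X) t.
Proof. by rewrite !translateE. Qed.

(** Testing the translate of X against Y is testing X against the translate of
    Y by the opposite vector. *)
Lemma measurable_translate X t : measurable X -> measurable (translate X t).
Proof.
have cara Y : measurable Y <-> caratheodory_measurable (@lebesgue R d) Y by [].
move=> /cara mX; apply/cara => Y; rewrite !(setIC Y) translateC !translateI.
rewrite !lebesgue_translate !(setIC _ (translate Y _)).
by rewrite -[LHS](lebesgue_translate Y (- t)); exact: mX.
Qed.

(** Corners of the two boxes into which the hyperplane x_i = r cuts the box with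
    corners p; one of them is degenerate when the hyperplane misses the box. *)
Definition lower_part i (r : R) (p : 'rV[R]_d * 'rV[R]_d) :=
  (p.1, \row_j (if j == i then Num.min (p.2 0 j) r else p.2 0 j)).

Definition upper_part i (r : R) (p : 'rV[R]_d * 'rV[R]_d) :=
  (\row_j (if j == i then Num.max (p.1 0 j) r else p.1 0 j), p.2).

Lemma volume_cut i r (p : 'rV[R]_d * 'rV[R]_d) :
  volume (lower_part i r p).1 (lower_part i r p).2
  + volume (upper_part i r p).1 (upper_part i r p).2 = volume p.1 p.2.
Proof.
have volumeD1 a b : volume a b = Num.max 0 (b 0 i - a 0 i) *
    \prod_(j | j != i) Num.max 0 (b 0 j - a 0 j).
  by rewrite /volume (bigD1 i).
rewrite !volumeD1 !mxE eqxx.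
under eq_bigr => j /negPf ji do rewrite /= !mxE ji.
under [in X in _ + _ * X]eq_bigr => j /negPf ji do rewrite /= !mxE ji.
rewrite -mulrDl; congr (_ * _).
exact: max0_cut.
Qed.

(** Cutting every box of a covering of X along the boundary hyperplane gives
    coverings of the two parts of X with the same total volume. *)
Lemma measurable_halfspace i (r : R) :
  measurable [set x : 'rV[R]_d | x 0 i <= r].
Proof.
apply: (@le_caratheodory_measurable _ _ (@lebesgue_outer R d)) => X.
apply: le_ereal_inf_tmp => _ [C [cC XC] <-].
rewrite (eq_esum (b := fun p =>
    (volume (lower_part i r p).1 (lower_part i r p).2)%:E
    + (volume (upper_part i r p).1 (upper_part i r p).2)%:E)%E); last first.
  by move=> p _; rewrite -EFinD volume_cut.
rewrite esumD; try by move=> p _; exact: vol_ge0.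
apply: leeD.
  apply: (@le_trans _ _ (\esum_(p in lower_part i r @` C) (volume p.1 p.2)%:E)).
    apply: ereal_inf_lbound; exists (lower_part i r @` C) => //; split.
      by apply: sub_countable cC; exact: card_image_le.
    move=> x [/XC[p Cp px] /= xr]; exists (lower_part i r p); first by exists p.
    move=> j /=; rewrite mxE; have /andP[-> pj] := px j.
    by case: eqP => [->|//]; rewrite le_min xr andbT; have /andP[] := px i.
  exact: (esum_image_le C (lower_part i r) vol_ge0).
apply: (@le_trans _ _ (\esum_(p in upper_part i r @` C) (volume p.1 p.2)%:E)).
  apply: ereal_inf_lbound; exists (upper_part i r @` C) => //; split.
    by apply: sub_countable cC; exact: card_image_le.
  move=> x [/XC[p Cp px] /= /negP]; rewrite -ltNge => xr.
  exists (upper_part i r p); first by exists p.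
  move=> j /=; rewrite mxE; have /andP[pj ->] := px j; rewrite andbT.
  by case: eqP => [->|//]; rewrite gt_max xr andbT; have /andP[] := px i.
exact: (esum_image_le C (upper_part i r) vol_ge0).
Qed.

Lemma measurable_coord (i : 'I_d) :
  measurable_fun setT (fun x : 'rV[R]_d => x 0 i).
Proof.
apply: (measurability _ (RGenOInfty.measurableE R)) => _ [_ [r ->] <-].
rewrite setTI (_ : _ @^-1` _ = ~` [set x : 'rV[R]_d | x 0 i <= r]).
  exact: measurableC (measurable_halfspace i r).
by apply/seteqP; split => x /=; rewrite in_itv/= andbT ltNge => /negP.
Qed.

End outer_measure.

(** * Integration over non-overlapping translates *)

Section non_overlapping_union.
Context {disp : measure_display} {T : measurableType disp} {R : realType}.
Variable mu : {measure set T -> \bar R}.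

Lemma measure_bigsetU_eq0 (I : eqType) (F : I -> set T) (s : seq I) :
  (forall i, measurable (F i)) -> {in s, forall i, mu (F i) = 0%E} ->
  mu (\big[setU/set0]_(i <- s) F i) = 0%E.
Proof.
move=> mF; elim: s => [|i s IH] F0; first by rewrite big_nil.
rewrite big_cons measureU0 ?F0 ?mem_head//.
  by apply: bigsetU_measurable => j _; exact: mF.
by apply: IH => j js; apply: F0; rewrite inE js orbT.
Qed.

Lemma ge0_integral_bigsetU_null (I : eqType) (F : I -> set T) (s : seq I)
    (f : T -> \bar R) :
  (forall i, measurable (F i)) -> uniq s ->
  {in s &, forall i j, i != j -> mu (F i `&` F j) = 0%E} ->
  measurable_fun (\big[setU/set0]_(i <- s) F i) f -> (forall x, 0 <= f x)%E ->
  (\int[mu]_(x in \big[setU/set0]_(i <- s) F i) f x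
    = \sum_(i <- s) \int[mu]_(x in F i) f x)%E.
Proof.
(* Removing F i from the union of the other sets only discards a null set. *)
move=> mF + + + f0; elim: s => [|i s IH] /=;
  first by rewrite !big_nil integral_set0.
move=> /andP[si us] F0; rewrite !big_cons => mf.
have mU : measurable (\big[setU/set0]_(j <- s) F j).
  by apply: bigsetU_measurable => j _; exact: mF.
have mfU : measurable_fun (\big[setU/set0]_(j <- s) F j) f.
  by apply: measurable_funS mf => //; exact: measurableU.
rewrite -IH//; last first.
  by move=> j k js ks; apply: F0; rewrite inE (js, ks) orbT.
set U := \big[setU/set0]_(j <- s) F j in mf mU mfU *.
have -> : F i `|` U = F i `|` U `\` F i by rewrite setUDr setDv setD0.
have mUF : measurable (U `\` F i) by exact: measurableD.
rewrite ge0_integral_setU//; first last.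
- by rewrite disj_set2E setDIK.
- by rewrite setUDr setDv setD0.
congr (_ + _)%E.
have -> : U `\` F i = U `\` (U `&` F i) by rewrite setDIr setDv set0U.
rewrite -ge0_negligible_integral//; first exact: measurableI.
rewrite /U big_distrl/=.
apply: measure_bigsetU_eq0 => j; first exact: measurableI.
move=> js; apply: F0; rewrite ?mem_head// ?inE ?js ?orbT//.
by apply: contraNneq si => <-.
Qed.

End non_overlapping_union.

Section translation.
Context {R : realType} {d : nat}.
Implicit Types (b t x : 'rV[R]_d) (Omega : set 'rV[R]_d) (B : {fset 'rV[R]_d}).

Lemma measurable_shift t : measurable_fun setT (fun x : 'rV[R]_d => x + t).
Proof.
move=> _ Y mY; rewrite setTI (_ : _ @^-1` _ = translate Y (- t)).
  exact: measurable_translate.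
by rewrite translateE; apply/seteqP; split => x /=; rewrite opprK.
Qed.

Lemma measurable_fun_shift d' (T : measurableType d') Omega t
    (f : 'rV[R]_d -> T) : measurable Omega ->
  measurable_fun (translate Omega t) f ->
  measurable_fun Omega (fun x => f (x + t)).
Proof.
move=> mO mf; apply: (measurable_comp (measurable_translate t mO) _ mf).
  by move=> _ [x Ox <-]; exists x.
by apply: measurable_funTS; exact: measurable_shift.
Qed.

(** Translation invariance says that Lebesgue measure is its own pushforward by
    a translation. *)
Lemma ge0_integral_translate Omega t (f : 'rV[R]_d -> \bar R) :
  measurable Omega -> measurable_fun (translate Omega t) f ->
  (forall x, 0 <= f x)%E ->
  (\int[lebesgue]_(x in translate Omega t) f x
    = \int[lebesgue]_(x in Omega) f (x + t)%R)%E.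
Proof.
move=> mO mf f0.
have mt := measurable_translate t mO.
pose phi : {mfun 'rV[R]_d >-> 'rV[R]_d} :=
  HB.pack (fun x => x + t) (isMeasurableFun.Build _ _ _ _ _ (measurable_shift t)).
rewrite (eq_measure_integral (pushforward lebesgue phi)).
  rewrite ge0_integral_pushforward//.
  congr (integral _ _ _).
  by rewrite translateE; apply/seteqP; split => x /=; rewrite addrK.
move=> Y mY _; rewrite /pushforward -[RHS](lebesgue_translate _ t) translateE.
by congr lebesgue; apply/seteqP; split => x /=; rewrite subrK.
Qed.

Lemma measurable_translates Omega B :
  measurable Omega -> measurable (translates Omega B).
Proof.
move=> mO; rewrite /translates bigcup_fset.
by apply: bigsetU_measurable => b _; exact: measurable_translate.
Qed.

Definition non_overlapping Omega B := forall b b', b \in B -> b' \in B ->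
  b != b' -> lebesgue (translate Omega b `&` translate Omega b') = 0%E.

Definition periodize (V : nmodType) B (f : 'rV[R]_d -> V) x : V :=
  \sum_(b <- B) f (x + b).

Lemma measurable_fun_periodize Omega B (f : 'rV[R]_d -> R) :
  measurable Omega -> measurable_fun (translates Omega B) f ->
  measurable_fun Omega (periodize B f).
Proof.
move=> mO mf.
(* The truncation makes every summand measurable, also when b is not in B. *)
pose g b x := if b \in B then f (x + b) else 0.
rewrite (_ : periodize B f = fun x => \sum_(b <- B) g b x); last first.
  by apply/funext => x; apply: eq_big_seq => b bB; rewrite /g bB.
apply: measurable_sum => b; have [bB|/negPf bB] := boolP (b \in B);
    rewrite /g bB; last exact: measurable_cst.
apply: measurable_fun_shift => //; apply: measurable_funS mf.
  exact: measurable_translates.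
by move=> x ?; exists b.
Qed.

Lemma ge0_integral_periodize Omega B (f : 'rV[R]_d -> R) :
  measurable Omega -> non_overlapping Omega B ->
  measurable_fun (translates Omega B) f -> (forall x, 0 <= f x) ->
  (\int[lebesgue]_(x in translates Omega B) (f x)%:E
    = \int[lebesgue]_(x in Omega) (periodize B f x)%:E)%E.
Proof.
move=> mO nO mf f0; have mfb b : b \in B -> measurable_fun (translate Omega b) f.
  move=> bB; apply: measurable_funS mf; first exact: measurable_translates.
  by move=> x ?; exists b.
rewrite [translates _ _]bigcup_fset ge0_integral_bigsetU_null//; first last.
- by rewrite -bigcup_fset; exact/measurable_EFinP.
- by move=> b; exact: measurable_translate.
pose g b x := if b \in B then (f (x + b))%:E else 0%E.
transitivity (\sum_(b <- B) \int[lebesgue]_(x in Omega) g b x)%E.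
  apply: eq_big_seq => b bB; rewrite ge0_integral_translate//.
    by rewrite /g bB.
  exact/measurable_EFinP/mfb.
rewrite -ge0_integral_sum//.
- apply: eq_integral => x _; rewrite /periodize -sumEFin.
  by apply: eq_big_seq => b bB; rewrite /g bB.
- move=> b; have [bB|/negPf bB] := boolP (b \in B);
    rewrite /g bB; last exact: measurable_cst.
  by apply/measurable_EFinP/measurable_fun_shift => //; exact: mfb.
- by move=> b x _; rewrite /g; case: ifP => _ //; rewrite lee_fin.
Qed.

Let ge0_integrable_periodize Omega B (f : 'rV[R]_d -> R) :
  measurable Omega -> non_overlapping Omega B -> (forall x, 0 <= f x) ->
  lebesgue.-integrable (translates Omega B) (EFin \o f) ->
  lebesgue.-integrable Omega (EFin \o periodize B f).
Proof.
move=> mO nO f0 /integrableP[mf foo]; apply/integrableP; split.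
  by apply/measurable_EFinP/measurable_fun_periodize => //; exact/measurable_EFinP.
have p0 x : 0 <= periodize B f x by apply: sumr_ge0.
under eq_integral => x _ do rewrite /= ger0_norm//.
rewrite -ge0_integral_periodize//; last exact/measurable_EFinP.
by under eq_integral => x _ do rewrite -(ger0_norm (f0 x)).
Qed.

(** Reduces to the nonnegative case through positive and negative parts. *)
Lemma Rintegral_periodize Omega B (f : 'rV[R]_d -> R) :
  measurable Omega -> non_overlapping Omega B ->
  lebesgue.-integrable (translates Omega B) (EFin \o f) ->
  \int[lebesgue]_(x in translates Omega B) f x
  = \int[lebesgue]_(x in Omega) periodize B f x.
Proof.
move=> mO nO intf; have mT := measurable_translates B mO.
have intp := integrable_funrpos mT intf; have intn := integrable_funrneg mT intf.
have ge0_case (g : 'rV[R]_d -> R) : (forall x, 0 <= g x) ->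
    lebesgue.-integrable (translates Omega B) (EFin \o g) ->
    \int[lebesgue]_(x in translates Omega B) g x
    = \int[lebesgue]_(x in Omega) periodize B g x.
  move=> g0 /integrableP[/measurable_EFinP mg _].
  by rewrite /Rintegral ge0_integral_periodize.
transitivity (\int[lebesgue]_(x in translates Omega B) (f^\+ x - f^\- x)).
  by apply: eq_Rintegral => x _; rewrite -[in LHS](funrposBneg f).
rewrite RintegralB// !ge0_case// -RintegralB//;
  try exact: ge0_integrable_periodize.
apply: eq_Rintegral => x _; rewrite /periodize -sumrB.
by apply: eq_bigr => b _; rewrite -[in RHS](funrposBneg f).
Qed.

End translation.

(** * Characters *)

Section characters.
Context {R : realType} {d : nat}.
Implicit Types (l x y : 'rV[R]_d) (z w : R[i]).

Lemma sqr_normcE z : Normc.normc z ^+ 2 = complex.Re z ^+ 2 + complex.Im z ^+ 2.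
Proof. by case: z => a b; rewrite sqr_sqrtr// addr_ge0 ?sqr_ge0. Qed.

Lemma normc_conj z : Normc.normc z^*%R = Normc.normc z.
Proof. by case: z => a b /=; rewrite sqrrN. Qed.

Lemma dotC x y : dot x y = dot y x.
Proof. by apply: eq_bigr => i _; rewrite mulrC. Qed.

Lemma dotDr l x y : dot l (x + y) = dot l x + dot l y.
Proof. by rewrite /dot -big_split; apply: eq_bigr => i _; rewrite mxE mulrDr. Qed.

Lemma expiC l x : expi l x = expi x l.
Proof. by rewrite /expi dotC. Qed.

Lemma expiDr l x y : expi l (x + y) = expi l x * expi l y.
Proof.
rewrite /expi dotDr mulrDr cosD sinD; apply/eqP.
by rewrite eq_complex /= eqxx/= [X in _ == X]addrC (mulrC (sin _)) eqxx.
Qed.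

Lemma expiDl l y x : expi (l + y) x = expi l x * expi y x.
Proof. by rewrite !(expiC _ x) expiDr. Qed.

Lemma normc_expi l x : Normc.normc (expi l x) = 1.
Proof. by rewrite /= cos2Dsin2 sqrtr1. Qed.

Lemma expi_dual l x : dot l x \is a Num.int -> expi l x = 1.
Proof.
move=> /intrP[m lx].
have cos_sin_nat (n : nat) :
    cos (2 * pi * n%:R) = 1 :> R /\ sin (2 * pi * n%:R) = 0 :> R.
  have -> : 2 * pi * n%:R = 0 + pi *+ 2 *+ n :> R.
    by rewrite add0r mulr_natr mulr_natl.
  by rewrite (periodicn (@cosD2pi R)) (periodicn (@sinD2pi R)) cos0 sin0.
rewrite /expi lx; case: m {lx} => n; first by have [-> ->] := cos_sin_nat n.
rewrite NegzE mulrNz mulrN cosN sinN -pmulrn.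
by have [-> ->] := cos_sin_nat n.+1; rewrite oppr0.
Qed.

Lemma measurable_Re_expi l :
  measurable_fun setT (fun x => complex.Re (expi l x)).
Proof.
apply: (measurableT_comp (continuous_measurable_fun (@continuous_cos R))).
apply: measurable_funM; first exact: measurable_cst.
apply: measurable_sum => i.
apply: measurable_funM; first exact: measurable_cst.
exact: measurable_coord.
Qed.

Lemma measurable_Im_expi l :
  measurable_fun setT (fun x => complex.Im (expi l x)).
Proof.
apply: (measurableT_comp (continuous_measurable_fun (@continuous_sin R))).
apply: measurable_funM; first exact: measurable_cst.
apply: measurable_sum => i.
apply: measurable_funM; first exact: measurable_cst.
exact: measurable_coord.
Qed.

Lemma Re_conjM z w :
  complex.Re (z^* * w)
  = complex.Re z * complex.Re w + complex.Im z * complex.Im w.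
Proof. by case: z w => [a b] [e f] /=; rewrite mulNr opprK. Qed.

Lemma Im_conjM z w :
  complex.Im (z^* * w)
  = complex.Re z * complex.Im w - complex.Im z * complex.Re w.
Proof. by case: z w => [a b] [e f] /=; rewrite mulNr. Qed.

Lemma Re_sum (I : Type) (s : seq I) (F : I -> R[i]) :
  complex.Re (\sum_(i <- s) F i) = \sum_(i <- s) complex.Re (F i).
Proof. by apply: (big_morph (@complex.Re R)) => // -[a b] [e f]. Qed.

Lemma Im_sum (I : Type) (s : seq I) (F : I -> R[i]) :
  complex.Im (\sum_(i <- s) F i) = \sum_(i <- s) complex.Im (F i).
Proof. by apply: (big_morph (@complex.Im R)) => // -[a b] [e f]. Qed.

End characters.

(** * Periodization and the Fourier transform *)

Section L2_functions.
Context {R : realType} {d : nat}.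
Implicit Types (l x : 'rV[R]_d) (D Omega : set 'rV[R]_d) (B : {fset 'rV[R]_d})
  (f : 'rV[R]_d -> R[i]).

Lemma measurable_sqr_normc D f :
  measurable_fun D (fun x => complex.Re (f x)) ->
  measurable_fun D (fun x => complex.Im (f x)) ->
  measurable_fun D (fun x => Normc.normc (f x) ^+ 2).
Proof.
move=> mr mi; under eq_fun do rewrite sqr_normcE.
by apply: measurable_funD; apply: measurable_funX.
Qed.

Lemma sqnormL2_expi D f l :
  sqnormL2 D (fun x => (expi l x)^* * f x) = sqnormL2 D f.
Proof.
by apply: eq_integral => x _; rewrite Normc.normcM normc_conj normc_expi mul1r.
Qed.

Lemma L2_expi D f l : L2 D f -> L2 D (fun x => (expi l x)^* * f x).
Proof.
have me : measurable_fun D _ := measurable_funTS (measurable_Re_expi l).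
have me' : measurable_fun D _ := measurable_funTS (measurable_Im_expi l).
move=> [mr mi foo]; split; last by rewrite sqnormL2_expi.
  under eq_fun do rewrite Re_conjM.
  exact: measurable_funD (measurable_funM me mr) (measurable_funM me' mi).
under eq_fun do rewrite Im_conjM.
exact: measurable_funB (measurable_funM me mi) (measurable_funM me' mr).
Qed.

(** On a set of finite measure, 1 + |f|^2 is integrable and dominates |f|. *)
Lemma L2_integrable D f : measurable D -> (lebesgue D < +oo)%E -> L2 D f ->
  lebesgue.-integrable D (EFin \o (fun x => complex.Re (f x))) /\
  lebesgue.-integrable D (EFin \o (fun x => complex.Im (f x))).
Proof.
move=> mD Doo [mr mi foo].
have dom : lebesgue.-integrable D (fun x => 1 + (Normc.normc (f x) ^+ 2)%:E)%E.
  apply: integrableD => //.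
    apply/integrableP; split; first exact: measurable_cst.
    by under eq_integral do rewrite abse1; rewrite integral_cst// mul1e.
  apply/integrableP; split; first exact/measurable_EFinP/measurable_sqr_normc.
  by under eq_integral do rewrite gee0_abs ?lee_fin ?sqr_ge0//.
have bound (a b : R) : `|a| <= 1 + (a ^+ 2 + b ^+ 2).
  have := sqr_ge0 (`|a| - 1); rewrite sqrrB1 real_normK ?num_real// => h.
  have := normr_ge0 a; have := sqr_ge0 b; have := sqr_ge0 a; lra.
split; apply: le_integrable dom => //; try exact/measurable_EFinP;
  move=> x _; rewrite -EFinD !abse_EFin lee_fin;
  rewrite [leRHS]ger0_norm ?addr_ge0 ?sqr_ge0// sqr_normcE ?bound//.
by rewrite [X in 1 + X]addrC bound.
Qed.

Lemma cintegral_periodize Omega B f :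
  measurable Omega -> non_overlapping Omega B ->
  (lebesgue (translates Omega B) < +oo)%E -> L2 (translates Omega B) f ->
  cintegral (translates Omega B) f = cintegral Omega (periodize B f).
Proof.
move=> mO nO Doo L2f.
have [ir ii] := L2_integrable (measurable_translates B mO) Doo L2f.
rewrite /cintegral !Rintegral_periodize//.
by congr (_ +i* _); apply: eq_Rintegral => x _;
  rewrite /periodize (Re_sum, Im_sum).
Qed.

(** The character e_lambda is invariant under the translations by B, hence
    factors out of the periodization; only e_l remains inside. *)
Lemma fourier_periodize Omega B f lambda l :
  measurable Omega -> non_overlapping Omega B ->
  (lebesgue (translates Omega B) < +oo)%E -> L2 (translates Omega B) f ->
  {in B, forall b, dot b lambda \is a Num.int} ->
  fourier (translates Omega B) f (lambda + l)
  = fourier Omega (periodize B (fun x => (expi l x)^* * f x)) lambda.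
Proof.
move=> mO nO Doo L2f dual.
have L2e := L2_expi (lambda + l) L2f.
rewrite /fourier (cintegral_periodize mO nO Doo L2e).
congr cintegral; apply/funext => x; rewrite /periodize mulr_sumr.
apply: eq_big_seq => b bB.
have -> : expi (lambda + l) (x + b) = expi lambda x * expi l (x + b).
  by rewrite expiDl expiDr (expiC lambda b) (expi_dual (dual b bB)) mulr1.
by rewrite rmorphM/= mulrA.
Qed.

End L2_functions.

(** * Hermitian forms of Gram matrices *)

Section forms.
Context {R : realType}.
Implicit Types (n m : nat).

Lemma sqnorml2_ge0 n (v : 'cV[R[i]]_n) : 0 <= sqnorml2 v.
Proof. by apply: sumr_ge0 => i _; exact: sqr_ge0. Qed.

Lemma innerE n (u v : 'cV[R[i]]_n) : inner u v = (u^t* *m v) 0 0.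
Proof. by rewrite mxE; apply: eq_bigr => i _; rewrite !mxE. Qed.

Lemma inner_diag n (v : 'cV[R[i]]_n) : inner v v = (sqnorml2 v)%:C.
Proof.
rewrite /inner /sqnorml2 rmorph_sum/=; apply: eq_bigr => i _.
rewrite sqr_normcE; case: (v i 0) => a b; apply/eqP.
by rewrite eq_complex /= !mulNr opprK [b * a]mulrC subrr !eqxx.
Qed.

Lemma inner_gram m n (M : 'M[R[i]]_(m, n)) v :
  inner v (M^t* *m M *m v) = (sqnorml2 (M *m v))%:C.
Proof.
by rewrite -inner_diag !innerE trmx_mul map_mxM !mulmxA.
Qed.

Lemma form_bounds_gram m n (M : 'M[R[i]]_(m, n)) p P :
  form_bounds (M^t* *m M) p P <->
  forall v, p * sqnorml2 v <= sqnorml2 (M *m v) <= P * sqnorml2 v.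
Proof. by split=> h v; have := h v; rewrite inner_gram !lecR. Qed.

Lemma normc_ge0 (z : R[i]) : 0 <= Normc.normc z.
Proof. by case: z => a b; exact: sqrtr_ge0. Qed.

Lemma normc_sum_le (I : Type) (s : seq I) (F : I -> R[i]) :
  Normc.normc (\sum_(i <- s) F i) <= \sum_(i <- s) Normc.normc (F i).
Proof.
elim/big_rec2: _ => [|i y x _ h]; first by rewrite Normc.normc0.
by apply: le_trans (le_normcD _ _) _; rewrite lerD2l.
Qed.

Lemma sqnorml2_mulmx_bounded m n (M : 'M[R[i]]_(m, n)) :
  exists2 C : R, 0 < C & forall v, sqnorml2 (M *m v) <= C * sqnorml2 v.
Proof.
(* Each |v_j| is at most |v|, so the i-th entry of M v is at most r i |v|. *)
pose r i := \sum_j Normc.normc (M i j).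
exists (1 + \sum_i r i ^+ 2) => [|v].
  by rewrite ltr_pwDl// sumr_ge0// => i _; exact: sqr_ge0.
apply: (@le_trans _ _ ((\sum_i r i ^+ 2) * sqnorml2 v)); last first.
  by rewrite ler_wpM2r ?sqnorml2_ge0// lerDr.
rewrite mulr_suml; apply: ler_sum => i _; rewrite mxE.
have s0 := sqnorml2_ge0 v.
have r0 : 0 <= r i by apply: sumr_ge0 => j _; exact: normc_ge0.
rewrite -[sqnorml2 v]sqr_sqrtr// -exprMn.
apply: lerXn2r; rewrite ?nnegrE ?normc_ge0 ?mulr_ge0 ?sqrtr_ge0//.
apply: le_trans (normc_sum_le _ _) _.
rewrite mulr_suml; apply: ler_sum => j _; rewrite Normc.normcM.
rewrite ler_wpM2l ?normc_ge0// -[leLHS]ger0_norm ?normc_ge0// -sqrtr_sqr.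
rewrite ler_wsqrtr// /sqnorml2 (bigD1 j)//= lerDl.
by apply: sumr_ge0 => k _; exact: sqr_ge0.
Qed.

Lemma bounded_belowP n (A : 'M[R[i]]_n) :
  bounded_below A <->
  exists2 c : R, 0 < c & forall v, c * sqnorml2 v <= sqnorml2 (A *m v).
Proof.
split=> -[c c0 h].
  exists (c ^+ 2) => [|v]; first exact: exprn_gt0.
  rewrite -(@ler_sqrt _ (_ * _)) ?sqnorml2_ge0// sqrtrM ?sqr_ge0//.
  by rewrite sqrtr_sqr gtr0_norm.
exists (Num.sqrt c) => [|v]; first by rewrite sqrtr_gt0.
by rewrite -sqrtrM ?(ltW c0)// ler_sqrt ?sqnorml2_ge0.
Qed.

Lemma sqnorml2_eq0 n (v : 'cV[R[i]]_n) : sqnorml2 v = 0 -> v = 0.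
Proof.
move=> v0; apply/colP => i; rewrite mxE; apply: Normc.eq0_normc; apply/eqP.
rewrite -sqrf_eq0; move: v0 => /eqP; rewrite psumr_eq0 => [|? _]; last exact: sqr_ge0.
by move=> /allP /(_ i); rewrite mem_index_enum => /(_ isT).
Qed.

Lemma bounded_below_unitmx n (A : 'M[R[i]]_n) :
  bounded_below A <-> A \in unitmx.
Proof.
rewrite bounded_belowP; split=> [[c c0 h]|uA].
  (* kermx is a kernel on row vectors, so it is applied to the transpose. *)
  rewrite -unitmx_tr -row_free_unit -kermx_eq0; apply/eqP/row_matrixP => i.
  apply: trmx_inj; rewrite row0 trmx0; apply: sqnorml2_eq0; apply/eqP.
  rewrite eq_le sqnorml2_ge0 andbT -(pmulr_rle0 _ c0).
  apply: le_trans (h _) _.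
  have -> : A *m (row i (kermx A^T))^T = 0.
    by rewrite -[A in A *m _]trmxK -trmx_mul -row_mul mulmx_ker row0 trmx0.
  by rewrite /sqnorml2 big1// => j _; rewrite mxE Normc.normc0 expr0n.
have [C C0 hC] := sqnorml2_mulmx_bounded (invmx A).
exists C^-1 => [|v]; first by rewrite invr_gt0.
by rewrite mulrC ler_pdivrMr// mulrC; have := hC (A *m v); rewrite mulKmx.
Qed.

(** If c |v|^2 <= |M^* M v|^2 and |M^* w|^2 <= C' |w|^2, then taking w = M v
    gives the lower bound c / C' for |M v|^2 = <v, M^* M v>. *)
Lemma gram_form_bounds m n (M : 'M[R[i]]_(m, n)) : bounded_below (M^t* *m M) ->
  exists p P : R, 0 < p /\ form_bounds (M^t* *m M) p P.
Proof.
move=> /bounded_belowP[c c0 hc].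
have [C _ hC] := sqnorml2_mulmx_bounded M.
have [C' C'0 hC'] := sqnorml2_mulmx_bounded (M^t*).
exists (c / C'), C; split; first exact: divr_gt0.
apply/form_bounds_gram => v; rewrite hC andbT mulrAC ler_pdivrMr// [leRHS]mulrC.
by apply: le_trans (hc v) _; rewrite -mulmxA.
Qed.

End forms.

(** * Assembling the spectral pair *)

Section spectral_sum.
Context {R : realType} {d : nat}.
Implicit Types (l x : 'rV[R]_d) (Omega Lambda : set 'rV[R]_d)
  (B L : {fset 'rV[R]_d}) (f : 'rV[R]_d -> R[i]).

Lemma esum_translates Lambda L (a : 'rV[R]_d -> \bar R) :
  (forall l l', l \in L -> l' \in L -> l != l' ->
    translate Lambda l `&` translate Lambda l' = set0) ->
  (forall x, 0 <= a x)%E ->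
  (\esum_(x in translates Lambda L) a x
    = \sum_(l <- L) \esum_(lambda in Lambda) a (lambda + l)%R)%E.
Proof.
move=> disj a0.
have -> : (\sum_(l <- L) \esum_(lambda in Lambda) a (lambda + l)%R)%E
    = \esum_(l in [set` L]) \esum_(lambda in Lambda) a (lambda + l).
  rewrite esum_fset// => [|l _]; last exact: esum_ge0.
  by rewrite fsbig_finite//= set_fsetK.
rewrite esum_esum//.
apply: (reindex_esum _ _ (fun p : 'rV[R]_d * 'rV[R]_d => p.2 + p.1)); split.
- by move=> [l x] [/= lL Lx]; exists l => //; exists x.
- move=> [l x] [l' x'] /[!inE] -[/= lL Lx] [/= l'L Lx'] e.
  have ll' : l = l'.
    apply/eqP/negP => /negP ll'; have := disj _ _ lL l'L ll'.
    by move/seteqP => [/(_ (x + l)) + _]; apply; split; [exists x|exists x'].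
  by move: e; rewrite ll' => /addIr ->.
- by move=> _ [l lL [x Lx <-]]; exists (l, x).
Qed.

(** The values of f on x + B, conjugated because the Fourier transform involves
    the conjugates of the entries of exp_mx L B. *)
Definition samples B f x : 'cV[R[i]]_#|` B| :=
  \col_j (f (x + (enum_fset B)`_j))^*%R.

Lemma sum_enum_fset (V : nmodType) B (F : 'rV[R]_d -> V) :
  \sum_(b <- B) F b = \sum_(j < #|` B|) F (enum_fset B)`_j.
Proof. by rewrite (big_nth 0) big_mkord. Qed.

Lemma sqnorml2_samples B f x :
  sqnorml2 (samples B f x) = periodize B (fun y => Normc.normc (f y) ^+ 2) x.
Proof.
rewrite /periodize sum_enum_fset; apply: eq_bigr => j _.
by rewrite mxE normc_conj.
Qed.

(** The l-th entry of the product is, up to the factor e_l(x) of modulus one,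
    the conjugate of the periodization on the right. *)
Lemma sqnorml2_exp_mx_samples B L f x :
  sqnorml2 (exp_mx L B *m samples B f x)
  = \sum_(l <- L) Normc.normc (periodize B (fun y => (expi l y)^* * f y) x) ^+ 2.
Proof.
rewrite sum_enum_fset; apply: eq_bigr => i _; congr (_ ^+ 2).
set l := (enum_fset L)`_i.
rewrite -[RHS]normc_conj rmorph_sum sum_enum_fset.
rewrite (eq_bigr (fun j => expi l x * (exp_mx L B i j * samples B f x j 0))).
  by rewrite -mulr_sumr Normc.normcM normc_expi mul1r mxE.
move=> j _; rewrite !mxE; set e := expi l (x + _).
by rewrite rmorphM/= conjCK /e expiDr (expiC _ l) mulrA.
Qed.

(** The periodization of the constant 1 is the constant #|B|. *)
Lemma lebesgue_translates Omega B :
  measurable Omega -> non_overlapping Omega B ->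
  lebesgue (translates Omega B) = (#|` B|%:R%:E * lebesgue Omega)%E.
Proof.
move=> mO nO; have mD := measurable_translates B mO.
rewrite -[LHS]mul1e -(integral_cst lebesgue mD 1).
rewrite (ge0_integral_periodize (f := cst 1))//.
rewrite -integral_cst//; apply: eq_integral => x _.
by rewrite /periodize sum_enum_fset sumr_const card_ord.
Qed.

Section synthesis.
Variables (Omega Lambda : set 'rV[R]_d) (k K : R) (B L : {fset 'rV[R]_d}).
Hypothesis hpair : generalized_spectral_pair Omega Lambda k K.
Hypothesis hB : non_overlapping Omega B.
Hypothesis hL : forall l l', l \in L -> l' \in L -> l != l' ->
  translate Lambda l `&` translate Lambda l' = set0.
Hypothesis hdual : [set` B] `<=` dual_set Lambda.
Variables p P : R.
Hypothesis p0 : 0 < p.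
Hypothesis hform : forall v,
  p * sqnorml2 v <= sqnorml2 (exp_mx L B *m v) <= P * sqnorml2 v.

Let mO : measurable Omega. Proof. by case: hpair. Qed.
Let mD : measurable (translates Omega B).
Proof. exact: measurable_translates. Qed.

Let form_bounds_le : B != fset0 -> p <= P.
Proof.
move=> /fset0Pn[b bB]; pose v : 'cV[R[i]]_#|` B| := const_mx 1.
have B0 : (0 < #|` B|)%N by rewrite cardfs_gt0; apply/fset0Pn; exists b.
have v0 : 0 < sqnorml2 v.
  rewrite /sqnorml2 (eq_bigr (fun=> 1)); last first.
    by move=> i _; rewrite mxE Normc.normc1 expr1n.
  by rewrite sumr_const card_ord ltr0n.
by rewrite -(ler_pM2r v0); have /andP[lo up] := hform v; exact: le_trans up.
Qed.

Let g f l := periodize B (fun y => (expi l y)^* * f y).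

Let measurable_g f l : L2 (translates Omega B) f ->
  measurable_fun Omega (fun x => complex.Re (g f l x)) /\
  measurable_fun Omega (fun x => complex.Im (g f l x)).
Proof.
move=> /(L2_expi l)[mr mi _]; split.
  under eq_fun do rewrite /g /periodize Re_sum.
  exact: (measurable_fun_periodize mO mr).
under eq_fun do rewrite /g /periodize Im_sum.
exact: (measurable_fun_periodize mO mi).
Qed.

(** The form bounds hold pointwise for v = samples B f x; integrate them. *)
Lemma sum_sqnormL2_bounds f : L2 (translates Omega B) f -> 0 <= P ->
  (p%:E * sqnormL2 (translates Omega B) f
    <= \sum_(l <- L) sqnormL2 Omega (g f l)
    <= P%:E * sqnormL2 (translates Omega B) f)%E.
Proof.
move=> L2f P0; have [mr mi foo] := L2f.
pose S := periodize B (fun y => Normc.normc (f y) ^+ 2).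
pose N x := \sum_(l <- L) Normc.normc (g f l x) ^+ 2.
have msqr := measurable_sqr_normc mr mi.
have mS : measurable_fun Omega S := measurable_fun_periodize mO msqr.
have mgl l : measurable_fun Omega (fun x => Normc.normc (g f l x) ^+ 2).
  by have [? ?] := measurable_g l L2f; exact: measurable_sqr_normc.
have mN : measurable_fun Omega N by exact: measurable_sum.
have S0 x : 0 <= S x by apply: sumr_ge0 => b _; exact: sqr_ge0.
have N0 x : 0 <= N x by apply: sumr_ge0 => l _; exact: sqr_ge0.
have -> : (sqnormL2 (translates Omega B) f
    = \int[lebesgue]_(x in Omega) (S x)%:E)%E.
  exact: (ge0_integral_periodize mO hB msqr (fun x => sqr_ge0 _)).
have -> : (\sum_(l <- L) sqnormL2 Omega (g f l)
    = \int[lebesgue]_(x in Omega) (N x)%:E)%E.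
  have g0 l x : Omega x -> (0 <= (Normc.normc (g f l x) ^+ 2)%:E)%E.
    by move=> _; rewrite lee_fin sqr_ge0.
  have mEg l : measurable_fun Omega (fun x => (Normc.normc (g f l x) ^+ 2)%:E).
    exact/measurable_EFinP/mgl.
  rewrite -(ge0_integral_sum lebesgue mO mEg g0).
  by apply: eq_integral => x _; rewrite sumEFin.
have SN x : p * S x <= N x <= P * S x.
  by rewrite /S /N -sqnorml2_samples -sqnorml2_exp_mx_samples; exact: hform.
have mES : measurable_fun Omega (EFin \o S) by exact/measurable_EFinP.
have mEN : measurable_fun Omega (EFin \o N) by exact/measurable_EFinP.
have ES0 x : Omega x -> (0 <= (S x)%:E)%E by rewrite lee_fin.
have EN0 x : Omega x -> (0 <= (N x)%:E)%E by rewrite lee_fin.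
have scale (c : R) : 0 <= c ->
    (c%:E * \int[lebesgue]_(x in Omega) (S x)%:E
      = \int[lebesgue]_(x in Omega) (c%:E * (S x)%:E))%E.
  by move=> c0; rewrite (ge0_integralZl lebesgue mO mES) ?lee_fin.
have mcS (c : R) : measurable_fun Omega (fun x => (c%:E * (S x)%:E)%E).
  exact: measurable_funeM.
have cS0 (c : R) x : 0 <= c -> Omega x -> (0 <= c%:E * (S x)%:E)%E.
  by move=> c0 _; rewrite mule_ge0// lee_fin.
rewrite !scale ?(ltW p0)//; apply/andP; split.
  apply: (ge0_le_integral lebesgue mO _ (mcS p) mEN) => x Ox.
    exact: cS0 (ltW p0) Ox.
  by rewrite -EFinM lee_fin; case/andP: (SN x).
apply: (ge0_le_integral lebesgue mO EN0 mEN (mcS P)) => x Ox.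
by rewrite -EFinM lee_fin; case/andP: (SN x).
Qed.

Lemma spectral_pair_synthesis : B != fset0 ->
  generalized_spectral_pair (translates Omega B) (translates Lambda L)
    (k * p) (K * P).
Proof.
move=> B0; have pP := form_bounds_le B0.
have P0 : 0 < P by exact: lt_le_trans pP.
case: (hpair) => _ /andP[posO finO] /andP[k0 kK] frame.
have K0 : 0 < K by exact: lt_le_trans kK.
have nB0 : (0 < #|` B|)%N by rewrite cardfs_gt0.
have Doo : (lebesgue (translates Omega B) < +oo)%E.
  by rewrite lebesgue_translates// lte_mul_pinfty.
split => //.
- by rewrite Doo andbT lebesgue_translates// mule_gt0// lte_fin ltr0n.
- by rewrite mulr_gt0//= ler_pM// ltW.
move=> f L2f.
have /andP[lo up] := sum_sqnormL2_bounds L2f (ltW P0).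
have L2g l : l \in L -> L2 Omega (g f l).
  (* Each norm is finite because their sum is, by the upper form bound. *)
  move=> lL; have [mr mi] := measurable_g l L2f; split => //.
  apply: (@le_lt_trans _ _ (\sum_(l <- L) sqnormL2 Omega (g f l))%E).
    rewrite (big_fsetD1 l)//= leeDl//.
    apply: sume_ge0 => l' _; apply: integral_ge0 => x _.
    by rewrite lee_fin sqr_ge0.
  apply: le_lt_trans up _.
  by case: L2f => _ _ foo; rewrite lte_mul_pinfty// lee_fin ltW.
have -> : (\esum_(lambda in translates Lambda L)
      (Normc.normc (fourier (translates Omega B) f lambda) ^+ 2)%:E
    = \sum_(l <- L) \esum_(lambda in Lambda)
      (Normc.normc (fourier Omega (g f l) lambda) ^+ 2)%:E)%E.
  rewrite esum_translates//; last by move=> x; rewrite lee_fin sqr_ge0.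
  apply: eq_bigr => l _; apply: eq_esum => lambda Llambda.
  rewrite (@fourier_periodize _ _ Omega)// => b bB.
  exact: hdual.
have sq0 l : (0 <= sqnormL2 Omega (g f l))%E.
  by apply: integral_ge0 => x _; rewrite lee_fin sqr_ge0.
apply/andP; split.
- rewrite EFinM -muleA.
  apply: (@le_trans _ _ (k%:E * \sum_(l <- L) sqnormL2 Omega (g f l))%E).
    by rewrite lee_pmul2l.
  rewrite ge0_sume_distrr//.
  rewrite !big_seq; apply: lee_sum => l lL.
  by have /andP[] := frame _ (L2g _ lL).
- rewrite EFinM -muleA.
  apply: (@le_trans _ _ (K%:E * \sum_(l <- L) sqnormL2 Omega (g f l))%E); last first.
    by rewrite lee_pmul2l.
  rewrite ge0_sume_distrr//.
  rewrite !big_seq; apply: lee_sum => l lL.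
  by have /andP[] := frame _ (L2g _ lL).
Qed.

End synthesis.

End spectral_sum.

Theorem theorem2p2p1 (R : realType) (d : nat)
    (Omega Lambda : set 'rV[R]_d) (k K : R) (B L : {fset 'rV[R]_d})
    (hpair : generalized_spectral_pair Omega Lambda k K)
    (hB0 : B != fset0)
    (hB : forall b b', b \in B -> b' \in B -> b != b' ->
      lebesgue (translate Omega b `&` translate Omega b') = 0%E)
    (hL : forall l l', l \in L -> l' \in L -> l != l' ->
      translate Lambda l `&` translate Lambda l' = set0)
    (hdual : [set` B] `<=` dual_set Lambda) :
  let A := (exp_mx L B)^t* *m exp_mx L B in
  (bounded_below A <-> A \in unitmx) /\
  (bounded_below A ->
    (exists p P : R, 0 < p /\ form_bounds A p P) /\
    (forall p P : R, 0 < p -> form_bounds A p P ->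
      generalized_spectral_pair (translates Omega B) (translates Lambda L)
        (k * p) (K * P))).
Proof.
split; first exact: bounded_below_unitmx.
move=> bA; split; first exact: gram_form_bounds.
move=> p P p0 /form_bounds_gram hform.
exact: spectral_pair_synthesis.
Qed.
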